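(* Let $G$ be a countable group and let $\nu$ and $\nu_n$ ($n\ge 1$) be probability measures on $G$ such that $\nu_n\to\nu$ weakly and $H(\nu_n)\to H(\nu)$. Then $$\limsup_{n\to\infty} H_\infty(\nu_n)\le H_\infty(\nu).$$
   Context: $G$ is regarded as a discrete space, so weak convergence of probability measures to a probability measure means $\nu_n(x)\to\nu(x)$ for each $x\in G$. The entropy of a probability measure $\mu$ on $G$ is $H(\mu)=\sum_{x\in G}-\mu(x)\log\mu(x)\in[0,\infty]$, with $0\log 0=0$. The asymptotic entropy of $\mu$ is $H_\infty(\mu)=\lim_{n\to\infty}\frac1n H(\mu^{*n})$, where $\mu^{*n}$ is the $n$-fold convolution of $\mu$ (the limit exists by subadditivity). *)

(* Defs.v *)
From HB Require Import structures.
From mathcomp Require Import all_boot all_order all_algebra.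
From mathcomp Require Import all_classical all_reals all_analysis.

Set Implicit Arguments.
Unset Strict Implicit.
Unset Printing Implicit Defensive.

Import Order.TTheory GRing.Theory Num.Theory.
Import numFieldTopology.Exports numFieldNormedType.Exports.

Local Open Scope classical_set_scope.
Local Open Scope ring_scope.

(* Alias of a group carrying the discrete sigma-algebra (every subset is
   measurable), so that the measures on a countable group are the library
   measures on this alias. *)
Definition discrete_group (G : groupType) : Type := G.

Section discrete_group_instances.
Variable G : groupType.

HB.instance Definition _ := Group.on (discrete_group G).
HB.instance Definition _ := isPointed.Build (discrete_group G) (1%g : G).
HB.instance Definition _ := @isMeasurable.Build default_measure_display
  (discrete_group G) discrete_measurable discrete_measurable0
  discrete_measurableC discrete_measurableU.

Lemma discrete_group_measurable (A : set (discrete_group G)) : measurable A.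
Proof. by []. Qed.

Lemma discrete_group_measurable_fun d (T : sigmaRingType d)
  (D : set (discrete_group G)) (f : discrete_group G -> T) :
  measurable_fun D f.
Proof. by move=> _ B _; exact: discrete_group_measurable. Qed.

End discrete_group_instances.

Section convolution.
Context (R : realType) (G : groupType).
Local Open Scope ereal_scope.
Variables mu nu : probability (discrete_group G) R.

(* The law of the product x * y of independent x ~ mu and y ~ nu; on a countable
   group its mass at z is the sum over x of mu(x) nu(x^-1 z). *)
Definition convolution (A : set (discrete_group G)) : \bar R :=
  \int[mu]_x nu [set y | A (x * y)%g].

Let convolution0 : convolution set0 = 0.
Proof.
rewrite /convolution -[RHS](integral0 mu setT).
by apply: eq_integral => x _; rewrite (_ : [set y | _] = set0) ?measure0.
Qed.

Let convolution_ge0 A : 0 <= convolution A.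
Proof. by apply: integral_ge0 => x _; exact: measure_ge0. Qed.

Let convolution_sigma_additive : semi_sigma_additive convolution.
Proof.
move=> F _ tF _.
have -> : convolution (\bigcup_n F n) = \sum_(n <oo) convolution (F n).
  rewrite /convolution -integral_nneseries//.
  apply: eq_integral => x _.
  have -> : [set y | (\bigcup_n F n) (x * y)%g] =
      \bigcup_n [set y | F n (x * y)%g] by [].
  rewrite measure_bigcup//; first by apply: eq_eseriesl => i; rewrite in_setT.
  by move=> i j _ _ [y [Fi Fj]]; apply: (tF i j) => //; exists (x * y)%g.
by apply: is_cvg_ereal_nneg_natsum => n _; exact: convolution_ge0.
Qed.

HB.instance Definition _ := isMeasure.Build _ _ _ convolution
  convolution0 convolution_ge0 convolution_sigma_additive.

Let convolution_setT : convolution setT = 1.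
Proof.
rewrite /convolution (eq_integral (cst 1)).
  by rewrite integral_cst// mul1e; exact: probability_setT.
by move=> x _; exact: probability_setT.
Qed.

HB.instance Definition _ :=
  Measure_isProbability.Build _ _ _ convolution convolution_setT.

End convolution.

Section entropy.
Context (R : realType) (G : groupType).
Local Open Scope ereal_scope.
Implicit Types mu nu : probability (discrete_group G) R.

(* mu^{*0} is the unit mass at the identity. *)
Fixpoint convolution_power mu (n : nat) : probability (discrete_group G) R :=
  if n is n'.+1 then convolution mu (convolution_power mu n')
  else \d_(1%g : discrete_group G).

(* ln 0 = 0, so the terms of mass 0 vanish; all terms are nonnegative. *)
Definition entropy mu : \bar R :=
  \esum_(x in [set: discrete_group G])
    (- (fine (mu [set x]) * ln (fine (mu [set x]))))%:E.

(* The term of index 0 is irrelevant to the limit. *)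
Definition asymptotic_entropy mu : \bar R :=
  limn (fun n => (n%:R^-1)%:E * entropy (convolution_power mu n)).

(* On a discrete space, weak convergence of probability measures to a
   probability measure is convergence of the mass of each point. *)
Definition weakly_converges (nu_ : nat -> probability (discrete_group G) R) nu :=
  forall x : discrete_group G, nu_ n [set x] @[n --> \oo] --> nu [set x].

End entropy.

(* Main.v *)
(* If H(mu) is finite then H_oo(mu) = inf_k H(mu^{*k}) / k by subadditivity, so
   it suffices that H(nu_n^{*k}) --> H(nu^{*k}) for each k, which follows by
   induction from the continuity of entropy under convolution. For independent
   X ~ mu and Y ~ nu,
     H(mu * nu) + H(X, Y | XY) = H(mu) + H(nu),
   where both summands on the left are sums of nonnegative terms depending lower
   semicontinuously on the masses, hence lower semicontinuous by Fatou's lemma;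
   as their sum converges, so does each of them. If H(nu) is infinite, so is
   H(nu^{*k}) >= H(nu) for k >= 1. *)
Require Import Defs.
From HB Require Import structures.
From mathcomp Require Import all_boot all_order all_algebra.
From mathcomp Require Import all_classical all_reals all_analysis.
From mathcomp Require Import measurable_realfun ring lra.

Set Implicit Arguments.
Unset Strict Implicit.
Unset Printing Implicit Defensive.

Import Order.TTheory GRing.Theory Num.Theory.
Import numFieldTopology.Exports numFieldNormedType.Exports.

Local Open Scope ring_scope.
Local Open Scope classical_set_scope.
Local Open Scope ereal_scope.

(** * Unordered sums, and integrals over countable spaces *)

Lemma esumZl (R : realType) (T : choiceType) (I : set T) (c : R)
    (a : T -> \bar R) : (0 <= c)%R -> (forall i, 0 <= a i) ->
  \esum_(i in I) (c%:E * a i) = c%:E * \esum_(i in I) a i.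
Proof.
move=> c0 a0; rewrite /esum -ereal_supZl//; last first.
  by apply/set0P; exists (\sum_(i \in set0) a i); exists set0 => //; split.
congr ereal_sup; rewrite image_comp; apply: eq_imagel => X _ /=.
by rewrite ge0_mule_fsumr.
Qed.

Lemma exchange_esum (R : realType) (T1 T2 : choiceType)
    (a : T1 -> T2 -> \bar R) : (forall i j, 0 <= a i j) ->
  \esum_(i in [set: T1]) \esum_(j in [set: T2]) a i j =
  \esum_(j in [set: T2]) \esum_(i in [set: T1]) a i j.
Proof.
move=> a0; rewrite !esum_esum//.
rewrite (@reindex_esum _ _ _ (setT `*`` (fun=> setT)) _ (fun k => (k.2, k.1)))//.
split=> [[i j]//|[i j] [k l] _ _ [-> ->]//|[i j] _ /=].
by exists (j, i).
Qed.

(** An injection into the naturals cuts the space into countably many fibres, each empty or a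
    singleton, and the integral is additive over them. *)
Lemma ge0_integral_esum d (T : measurableType d) (R : realType)
    (mu : {measure set T -> \bar R}) (f : T -> \bar R) :
  countable [set: T] -> (forall A : set T, measurable A) ->
  (forall x, 0 <= f x) ->
  \int[mu]_x f x = \esum_(x in [set: T]) (mu [set x] * f x).
Proof.
move=> /countable_injP[h hinj] mT f0.
pose F n := h @^-1` [set n].
have FT : setT = \bigcup_n F n by apply/seteqP; split=> // x _; exists (h x).
have tF : trivIset setT F by move=> i j _ _ [x []]; rewrite /F/= => -> ->.
have mf (D : set T) : measurable_fun D f by move=> _ B _; exact: mT.
rewrite [in LHS]FT ge0_integral_bigcup// [in RHS]FT.
rewrite nneseries_sum_bigcup//; last first.
  by move=> x; rewrite mule_ge0.
apply: eq_eseriesr => n _.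
have [->|/set0P[x Fx]] := eqVneq (F n) set0.
  by rewrite integral_set0 esum_set0.
have -> : F n = [set x].
  apply/seteqP; split=> [y Fy|y ->//]; apply: hinj; rewrite ?inE//.
  by rewrite Fy Fx.
rewrite esum_set1 ?mule_ge0// (eq_integral (cst (f x))).
  by rewrite integral_cst// muleC.
by move=> y; rewrite inE => ->.
Qed.

(** * Lower limits of sequences and Fatou's lemma for sums *)

(* That is, [l <= liminf u]. *)
Definition liminf_ge (R : realType) (u : nat -> \bar R) (l : \bar R) :=
  forall c : R, c%:E < l -> \forall n \near \oo, c%:E < u n.

Lemma cvg_liminf_ge (R : realType) (u : nat -> \bar R) (l : R) :
  u n @[n --> \oo] --> l%:E -> liminf_ge u l%:E.
Proof.
move=> /fine_cvgP[ufin ul] c; rewrite lte_fin => cl.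
near=> n; have un : u n \is a fin_num by near: n.
by rewrite -(fineK un) lte_fin; near: n; exact: (cvgr_gt _ ul).
Unshelve. all: by end_near. Qed.

Lemma liminf_ge_ge0 (R : realType) (u : nat -> \bar R) :
  (forall n, 0 <= u n) -> liminf_ge u 0.
Proof. by move=> u0 c c0; apply: nearW => n; exact: lt_le_trans c0 (u0 n). Qed.

Lemma liminf_geD (R : realType) (u v : nat -> \bar R) (a b : R) :
  liminf_ge u a%:E -> liminf_ge v b%:E ->
  liminf_ge (fun n => u n + v n) (a + b)%:E.
Proof.
move=> ua vb c; rewrite lte_fin => cab.
pose e := ((a + b - c) / 2)%R.
have e0 : (0 < e)%R by rewrite /e; lra.
have ae : (a - e)%:E < a%:E by rewrite lte_fin; lra.
have be : (b - e)%:E < b%:E by rewrite lte_fin; lra.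
near=> n.
have -> : c%:E = (a - e)%:E + (b - e)%:E by rewrite -EFinD /e; congr EFin; lra.
by rewrite lteD//; near: n; [exact: ua|exact: vb].
Unshelve. all: by end_near. Qed.

Lemma liminf_ge_sum (R : realType) (T : eqType) (s : seq T)
    (u : nat -> T -> \bar R) (a : T -> R) :
  (forall i, i \in s -> liminf_ge (u ^~ i) (a i)%:E) ->
  liminf_ge (fun n => \sum_(i <- s) u n i) (\sum_(i <- s) a i)%R%:E.
Proof.
elim: s => [_|i s ih ua].
  by rewrite big_nil; apply: liminf_ge_ge0 => n; rewrite big_nil.
rewrite big_cons => c /(@liminf_geD _ (u ^~ i)) cc.
under eq_near do rewrite big_cons.
by apply: cc; [apply: ua; rewrite mem_head|
  apply: ih => j js; apply: ua; rewrite inE js orbT].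
Qed.

(** A number below the full sum is already below some finite partial sum, and for finite sums the
    termwise lower bounds add up. *)
Lemma fatou_esum (R : realType) (T : choiceType) (I : set T)
    (u : nat -> T -> \bar R) (a : T -> R) :
  (forall n i, 0 <= u n i) ->
  (forall i, I i -> liminf_ge (u ^~ i) (a i)%:E) ->
  liminf_ge (fun n => \esum_(i in I) u n i) (\esum_(i in I) (a i)%:E).
Proof.
move=> u0 ua c /ereal_sup_gt[_ [X [finX XI]] <-].
rewrite fsbig_finite//= sumEFin => /liminf_ge_sum cX.
near=> n.
suff : c%:E < \sum_(i \in X) u n i.
  by move/lt_le_trans; apply; apply: esum_ge; exists X.
rewrite fsbig_finite//; near: n; apply: cX => i.
by rewrite in_fset_set// inE => /XI; exact: ua.
Unshelve. all: by end_near. Qed.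

(** Only an upper bound on [u] is missing; it comes from subtracting the lower bound on [v] from the
    convergent sum, which is possible because [a] and [b] are finite. *)
Lemma liminf_ge_cvgl (R : realType) (u v : nat -> \bar R) (a b : R) :
  (forall n, 0 <= u n) -> (forall n, 0 <= v n) ->
  liminf_ge u a%:E -> liminf_ge v b%:E ->
  u n + v n @[n --> \oo] --> (a + b)%:E -> u n @[n --> \oo] --> a%:E.
Proof.
move=> u0 v0 ua vb /fine_cvgP[uvfin uv].
have ufin : \forall n \near \oo, u n \is a fin_num.
  by apply: filterS uvfin => n; rewrite fin_numD => /andP[].
apply/fine_cvgP; split => //; apply/cvgrPdist_lt => e e0.
(* Eventually [u + v < a + b + e / 2] and [v > b - e / 2], so that [u < a + e]. *)
have ae : (a - e)%:E < a%:E by rewrite lte_fin; lra.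
have be : (b - e / 2)%:E < b%:E by rewrite lte_fin; lra.
have abe : (a + b < a + b + e / 2)%R by lra.
near=> n => /=.
have : (fine (u n + v n) < a + b + e / 2)%R by near: n; exact: (cvgr_lt _ uv).
have : (a - e)%:E < u n by near: n; exact: ua.
have : (b - e / 2)%:E < v n by near: n; exact: vb.
have : u n + v n \is a fin_num by near: n.
rewrite fin_numD => /andP[un vn].
rewrite fineD// -(fineK un) -(fineK vn) !lte_fin /= ltr_norml => *.
by apply/andP; split; lra.
Unshelve. all: by end_near. Qed.

Lemma mul_lnB_ge0 (R : realType) (a s : R) :
  (0 <= a <= s -> 0 <= a * (ln s - ln a))%R.
Proof.
move=> /andP[]; rewrite le_eqVlt => /predU1P[<-|a0 as_]; first by rewrite mul0r.
by rewrite mulr_ge0 ?(ltW a0)// subr_ge0 ler_ln ?posrE// (lt_le_trans a0).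
Qed.

Lemma liminf_ge_mul_lnB (R : realType) (a_ s_ : nat -> R) (a s : R) :
  (forall n, 0 <= a_ n <= s_ n)%R -> (0 <= a <= s)%R ->
  a_ n @[n --> \oo] --> a -> s_ n @[n --> \oo] --> s ->
  liminf_ge (fun n => (a_ n * (ln (s_ n) - ln (a_ n)))%:E)
    (a * (ln s - ln a))%:E.
Proof.
move=> as_n /andP[]; rewrite le_eqVlt => /predU1P[<- _ _ _|a0 as_ ua us].
  by rewrite mul0r; apply: liminf_ge_ge0 => n; rewrite lee_fin mul_lnB_ge0.
have s0 : (0 < s)%R := lt_le_trans a0 as_.
apply/cvg_liminf_ge/cvg_EFin; first exact: nearW.
apply: cvgM => //; apply: cvgB.
  by apply: continuous_cvg us; exact: continuous_ln.
by apply: continuous_cvg ua; exact: continuous_ln.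
Qed.

(** * Point masses of probability measures and of convolutions *)

Section mass.
Context (R : realType) (G : groupType).
Implicit Types mu nu : probability (discrete_group G) R.

Definition mass mu (x : discrete_group G) : R := fine (mu [set x]).

Lemma massE mu x : mu [set x] = (mass mu x)%:E.
Proof. by rewrite /mass fineK// fin_num_measure. Qed.

Lemma mass_ge0 mu x : (0 <= mass mu x)%R.
Proof. exact: fine_ge0. Qed.

Lemma mass_le1 mu x : (mass mu x <= 1)%R.
Proof. by rewrite -lee_fin -massE probability_le1. Qed.

Lemma esum_translate (f : discrete_group G -> \bar R) (x : discrete_group G) :
  \esum_(z in setT) f (x^-1 * z)%g = \esum_(y in setT) f y.
Proof.
rewrite [RHS](@reindex_esum _ _ _ setT _ (fun z => x^-1 * z)%g)//.
split=> // [y z _ _|z _]; first exact: mulgI.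
by exists (x * z)%g => //; rewrite mulKg.
Qed.

Hypothesis cG : countable [set: G].

Lemma esum_mass mu : \esum_(x in setT) (mass mu x)%:E = 1.
Proof.
rewrite -(probability_setT mu) -[RHS]mul1e -integral_cst// ge0_integral_esum//.
by apply: eq_esum => x _; rewrite mule1 -massE.
Qed.

Lemma mass_convolution mu nu z :
  (mass (convolution mu nu) z)%:E =
  \esum_(x in setT) (mass mu x * mass nu (x^-1 * z)%g)%:E.
Proof.
rewrite -massE /= /convolution ge0_integral_esum//.
apply: eq_esum => x _; rewrite EFinM; congr (_ * _); first exact: massE.
rewrite -massE; congr (nu _); apply/seteqP; split=> y /=.
  by move=> <-; rewrite mulKg.
by move=> ->; rewrite mulVKg.
Qed.

Lemma mass_mul_le_convolution mu nu x z :
  (mass mu x * mass nu (x^-1 * z)%g <= mass (convolution mu nu) z)%R.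
Proof.
rewrite -lee_fin mass_convolution; apply: esum_ge; exists [set x].
  by split=> //; exact: finite_set1.
by rewrite fsbig_set1.
Qed.

End mass.

(** * Double sums, and the entropy of a convolution *)

Lemma esum_pair (R : realType) (T1 T2 : choiceType) (a : T1 -> T2 -> \bar R) :
  (forall i j, 0 <= a i j) ->
  \esum_(i in setT) \esum_(j in setT) a i j =
  \esum_(k in [set: T1 * T2]) a k.1 k.2.
Proof. by move=> a0; rewrite esum_esum//; congr esum; apply/seteqP; split. Qed.

Lemma esum2D (R : realType) (T1 T2 : choiceType) (a b : T1 -> T2 -> R) :
  (forall i j, 0 <= a i j)%R -> (forall i j, 0 <= b i j)%R ->
  \esum_(i in setT) \esum_(j in setT) (a i j)%:E +
  \esum_(i in setT) \esum_(j in setT) (b i j)%:E =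
  \esum_(i in setT) \esum_(j in setT) (a i j + b i j)%:E.
Proof.
move=> a0 b0; rewrite -esumD => [|i _|i _]; last 2 first.
- by apply: esum_ge0 => j _; exact: a0.
- by apply: esum_ge0 => j _; exact: b0.
apply: eq_esum => i _; under [RHS]eq_esum do rewrite EFinD.
by rewrite esumD// => j _; rewrite lee_fin.
Qed.

Section entropy.
Context (R : realType) (G : groupType).
Implicit Types mu nu : probability (discrete_group G) R.

Lemma entropy_term_ge0 mu x : (0 <= - (mass mu x * ln (mass mu x)))%R.
Proof. by rewrite -mulrN mulr_ge0 ?mass_ge0// oppr_ge0 ln_le0// mass_le1. Qed.

Lemma entropy_ge0 mu : 0 <= entropy mu.
Proof. by apply: esum_ge0 => x _; rewrite lee_fin entropy_term_ge0. Qed.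

Hypothesis cG : countable [set: G].

(* For independent X ~ mu and Y ~ nu, this is H(X, Y | XY); the pair (x, z)
   stands for X = x and XY = z. *)
Definition conditional_entropy mu nu : \bar R :=
  \esum_(k in [set: discrete_group G * discrete_group G])
    (mass mu k.1 * mass nu (k.1^-1 * k.2)%g *
     (ln (mass (convolution mu nu) k.2) -
      ln (mass mu k.1 * mass nu (k.1^-1 * k.2)%g)))%:E.

Lemma conditional_entropy_term_ge0 mu nu x z :
  (0 <= mass mu x * mass nu (x^-1 * z)%g *
     (ln (mass (convolution mu nu) z) -
      ln (mass mu x * mass nu (x^-1 * z)%g)))%R.
Proof.
by apply: mul_lnB_ge0; rewrite mulr_ge0 ?mass_ge0//= mass_mul_le_convolution.
Qed.

Lemma conditional_entropy_ge0 mu nu : 0 <= conditional_entropy mu nu.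
Proof.
by apply: esum_ge0 => -[x z] _; rewrite lee_fin conditional_entropy_term_ge0.
Qed.

(** The mass of z in front of the logarithm is expanded into its sum over x; the logarithm is a
    constant factor of that sum. *)
Lemma entropy_convolution_esum mu nu :
  entropy (convolution mu nu) =
  \esum_(x in setT) \esum_(z in setT)
    (mass mu x * mass nu (x^-1 * z)%g * - ln (mass (convolution mu nu) z))%:E.
Proof.
have lnr z : (0 <= - ln (mass (convolution mu nu) z))%R.
  by rewrite oppr_ge0 ln_le0// mass_le1.
rewrite exchange_esum => [|x z]; last by rewrite lee_fin !mulr_ge0 ?mass_ge0.
apply: eq_esum => z _; rewrite -/(mass _ z).
under eq_esum do rewrite mulrC EFinM.
rewrite esumZl// => [|x]; last by rewrite lee_fin mulr_ge0 ?mass_ge0.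
by rewrite -mass_convolution// -EFinM mulNr mulrC.
Qed.

(** The substitution y = x^-1 z separates the two variables, and the masses of [mu] sum to 1. This
    and the next lemma write the entropy of one factor as a double sum over x and z. *)
Lemma esum_massl mu (h : discrete_group G -> R) : (forall y, 0 <= h y)%R ->
  \esum_(x in setT) \esum_(z in setT) (mass mu x * h (x^-1 * z)%g)%:E =
  \esum_(y in setT) (h y)%:E.
Proof.
move=> h0; under eq_esum => x _ do
  rewrite (esum_translate (fun y => (mass mu x * h y)%:E)).
rewrite exchange_esum => [|x y]; last by rewrite lee_fin mulr_ge0 ?mass_ge0.
apply: eq_esum => y _; under eq_esum do rewrite mulrC EFinM.
by rewrite esumZl// => [|x]; rewrite ?lee_fin ?mass_ge0// esum_mass// mule1.
Qed.

Lemma esum_massr nu (h : discrete_group G -> R) : (forall x, 0 <= h x)%R ->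
  \esum_(x in setT) \esum_(z in setT) (h x * mass nu (x^-1 * z)%g)%:E =
  \esum_(x in setT) (h x)%:E.
Proof.
move=> h0; apply: eq_esum => x _.
rewrite (esum_translate (fun y => (h x * mass nu y)%:E)).
under eq_esum do rewrite EFinM.
by rewrite esumZl// => [|y]; rewrite ?lee_fin ?mass_ge0// esum_mass// mule1.
Qed.

(** With p, q, r the masses of x, x^-1 z and z under [mu], [nu] and their convolution, both sides
    become double sums over x and z, equal term by term: pq (- ln r) + pq (ln r - ln (pq)) = pq (-
    ln p) + pq (- ln q). *)
Lemma entropy_convolutionD mu nu :
  entropy (convolution mu nu) + conditional_entropy mu nu =
  entropy mu + entropy nu.
Proof.
have pos x z : (0 <= mass mu x * mass nu (x^-1 * z)%g *
    - ln (mass (convolution mu nu) z))%R.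
  by rewrite !mulr_ge0 ?mass_ge0// oppr_ge0 ln_le0// mass_le1.
rewrite entropy_convolution_esum /conditional_entropy.
rewrite -(esum_pair (a := fun x z => (mass mu x * mass nu (x^-1 * z)%g *
     (ln (mass (convolution mu nu) z) -
      ln (mass mu x * mass nu (x^-1 * z)%g)))%:E)) => [|x z]; last first.
  by rewrite lee_fin conditional_entropy_term_ge0.
have <- : _ = entropy mu := esum_massr nu (entropy_term_ge0 mu).
have <- : _ = entropy nu := esum_massl mu (entropy_term_ge0 nu).
rewrite !esum2D;
  try by move=> x z; rewrite ?mulr_ge0 ?mass_ge0 ?entropy_term_ge0.
- apply: eq_esum => x _; apply: eq_esum => z _; congr EFin.
  (* The logarithm of pq splits only for positive p and q; if one of them is 0, every term
     vanishes. *)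
  have := mass_ge0 mu x; rewrite le_eqVlt => /predU1P[<-|p0].
    by rewrite !(mul0r, oppr0, addr0).
  have := mass_ge0 nu (x^-1 * z)%g; rewrite le_eqVlt => /predU1P[<-|q0].
    by rewrite !(mul0r, mulr0, oppr0, addr0).
  by rewrite lnM ?posrE//; ring.
- exact: pos.
- exact: conditional_entropy_term_ge0.
Qed.

Lemma entropy_convolution_le mu nu :
  entropy (convolution mu nu) <= entropy mu + entropy nu.
Proof. by rewrite -entropy_convolutionD leeDl// conditional_entropy_ge0. Qed.

(* Gibbs' inequality: summing p q (- ln q) + p q <= p q (- ln r) + p r, which is
   ln (r / q) <= r / q - 1, gives H(nu) + 1 <= H(mu * nu) + 1. *)
Lemma entropy_convolution_ge mu nu :
  entropy nu <= entropy (convolution mu nu).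
Proof.
have lnr z : (0 <= - ln (mass (convolution mu nu) z))%R.
  by rewrite oppr_ge0 ln_le0// mass_le1.
(* Adding 1, the total mass, to both sides keeps every term nonnegative, as the unordered sums
   require. *)
rewrite -(leeD2rE _ _ (_ : 1 \is a fin_num))//.
rewrite -[X in _ + X <= _](esum_mass cG nu) [entropy nu]/entropy.
rewrite -esumD; first last.
- by move=> x _; rewrite lee_fin mass_ge0.
- by move=> x _; rewrite lee_fin entropy_term_ge0.
under eq_esum do rewrite -EFinD.
rewrite -(@esum_massl mu
  (fun y => - (mass nu y * ln (mass nu y)) + mass nu y)%R) => [|y]; last first.
  by rewrite addr_ge0 ?mass_ge0 ?entropy_term_ge0.
have <- : \esum_(x in setT) \esum_(z in setT)
    (mass mu x * mass (convolution mu nu) z)%:E = 1.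
  rewrite -[RHS](esum_mass cG mu); apply: eq_esum => x _.
  under eq_esum do rewrite EFinM.
  rewrite esumZl ?mass_ge0// => [|z]; last by rewrite lee_fin mass_ge0.
  by rewrite esum_mass// mule1.
rewrite entropy_convolution_esum esum2D; last 2 first.
- by move=> x z; rewrite !mulr_ge0 ?mass_ge0.
- by move=> x z; rewrite mulr_ge0 ?mass_ge0.
apply: le_esum => x _; apply: le_esum => z _; rewrite lee_fin.
have := mass_ge0 mu x; rewrite le_eqVlt => /predU1P[<-|p0].
  by rewrite !mul0r addr0.
rewrite -mulrA -mulrDr ler_wpM2l ?(ltW p0)//.
(* For q = 0 the ratio r / q is meaningless, but the claim reduces to r >= 0. *)
have := mass_ge0 nu (x^-1 * z)%g; rewrite le_eqVlt => /predU1P[<-|q0].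
  by rewrite !(mul0r, oppr0, add0r) mass_ge0.
have r0 : (0 < mass (convolution mu nu) z)%R.
  exact: lt_le_trans (mulr_gt0 p0 q0) (mass_mul_le_convolution cG mu nu x z).
have /le_ln1Dx : (-1 < mass (convolution mu nu) z / mass nu (x^-1 * z)%g - 1)%R.
  by rewrite ltrBrDr addNr divr_gt0.
rewrite addrC subrK ln_div ?posrE// lerBrDr ler_pdivlMr// => le_r.
lra.
Qed.

End entropy.

(** * Continuity of convolution and of its entropy *)

Section weak_convergence.
Context (R : realType) (G : groupType).
Implicit Types mu nu rho : probability (discrete_group G) R.

Lemma weakly_converges_mass
    (mu_ : nat -> probability (discrete_group G) R) mu :
  weakly_converges mu_ mu ->
  forall x, mass (mu_ n) x @[n --> \oo] --> mass mu x.
Proof. by move=> mu_mu x; apply: fine_cvg; rewrite -massE; exact: mu_mu. Qed.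

Lemma liminf_ge_entropy
    (mu_ : nat -> probability (discrete_group G) R) mu :
  weakly_converges mu_ mu ->
  liminf_ge (fun n => entropy (mu_ n)) (entropy mu).
Proof.
move=> /weakly_converges_mass mu_mu; apply: fatou_esum => [n x|x _].
  by rewrite lee_fin entropy_term_ge0.
(* This brings the entropy term into the form a (ln s - ln a) with s = 1. *)
have lnE (m : R) : (- (m * ln m) = m * (ln 1 - ln m))%R.
  by rewrite ln1 sub0r mulrN.
rewrite -!/(mass _ x) lnE.
under [X in liminf_ge X]eq_fun do rewrite -!/(mass _ x) lnE.
apply: (@liminf_ge_mul_lnB _ (fun n => mass (mu_ n) x) (cst 1%R)).
- by move=> n; rewrite mass_ge0 mass_le1.
- by rewrite mass_ge0 mass_le1.
- exact: mu_mu.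
- exact: cvg_cst.
Qed.

Hypothesis cG : countable [set: G].

Section sequences.
Context (mu nu : probability (discrete_group G) R).
Context (mu_ nu_ : nat -> probability (discrete_group G) R).
Hypotheses (mu_mu : weakly_converges mu_ mu) (nu_nu : weakly_converges nu_ nu).

Let cvg_mass_mul x z : (mass (mu_ n) x * mass (nu_ n) (x^-1 * z)%g)%R
  @[n --> \oo] --> (mass mu x * mass nu (x^-1 * z)%g)%R.
Proof. by apply: cvgM; exact: weakly_converges_mass. Qed.

Lemma liminf_ge_mass_convolution z :
  liminf_ge (fun n => (mass (convolution (mu_ n) (nu_ n)) z)%:E)
    (mass (convolution mu nu) z)%:E.
Proof.
rewrite mass_convolution//.
under [X in liminf_ge X]eq_fun do rewrite mass_convolution//.
apply: fatou_esum => [n x|x _]; first by rewrite lee_fin mulr_ge0 ?mass_ge0.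
by apply/cvg_liminf_ge/cvg_EFin; [exact: nearW|exact: cvg_mass_mul].
Qed.

(* Fatou's lemma bounds the mass of z from below, and that of its complement
   as well: no mass is lost. *)
Lemma weakly_converges_convolution :
  weakly_converges (fun n => convolution (mu_ n) (nu_ n)) (convolution mu nu).
Proof.
move=> z; rewrite massE; under eq_fun do rewrite massE.
have split1 rho : (mass rho z)%:E + \esum_(w in ~` [set z]) (mass rho w)%:E = 1.
  rewrite -(esum_mass cG rho) [RHS](esumID [set z])// => [|w _]; last first.
    by rewrite lee_fin mass_ge0.
  by rewrite !setTI esum_set1 ?lee_fin ?mass_ge0.
pose b := \esum_(w in ~` [set z]) (mass (convolution mu nu) w)%:E.
have b_fin : b \is a fin_num.
  have : 1 \is a @fin_num R by [].
  by rewrite -(split1 (convolution mu nu)) fin_numD => /andP[].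
apply: (@liminf_ge_cvgl _ _
  (fun n => \esum_(w in ~` [set z]) (mass (convolution (mu_ n) (nu_ n)) w)%:E)
  _ (fine b)).
- by move=> n; rewrite lee_fin mass_ge0.
- by move=> n; apply: esum_ge0 => w _; rewrite lee_fin mass_ge0.
- exact: liminf_ge_mass_convolution.
- rewrite fineK//; apply: fatou_esum => [n w|w _].
    by rewrite lee_fin mass_ge0.
  exact: liminf_ge_mass_convolution.
- rewrite EFinD (fineK b_fin) /b split1; under eq_fun do rewrite split1.
  exact: cvg_cst.
Qed.

(** The mass of z under the convolution converges too, so each term is lower semicontinuous and
    Fatou's lemma applies. *)
Lemma liminf_ge_conditional_entropy :
  liminf_ge (fun n => conditional_entropy (mu_ n) (nu_ n))
    (conditional_entropy mu nu).
Proof.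
apply: fatou_esum => [n [x z]|[x z] _] /=.
  by rewrite lee_fin conditional_entropy_term_ge0.
apply: liminf_ge_mul_lnB.
- by move=> n; rewrite mulr_ge0 ?mass_ge0//= mass_mul_le_convolution.
- by rewrite mulr_ge0 ?mass_ge0//= mass_mul_le_convolution.
- exact: cvg_mass_mul.
- exact: weakly_converges_mass weakly_converges_convolution z.
Qed.

Lemma cvg_entropy_convolution :
  entropy mu \is a fin_num -> entropy nu \is a fin_num ->
  entropy (mu_ n) @[n --> \oo] --> entropy mu ->
  entropy (nu_ n) @[n --> \oo] --> entropy nu ->
  entropy (convolution (mu_ n) (nu_ n)) @[n --> \oo] -->
    entropy (convolution mu nu).
Proof.
move=> mu_fin nu_fin cmu cnu.
(* Finiteness of the total passes to both nonnegative summands on the other side of the identity, so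
   that their lower bounds can be subtracted. *)
have : entropy mu + entropy nu \is a fin_num by rewrite fin_numD mu_fin.
rewrite -entropy_convolutionD// fin_numD => /andP[r_fin c_fin].
rewrite -(fineK r_fin).
apply: (@liminf_ge_cvgl _ _ (fun n => conditional_entropy (mu_ n) (nu_ n))
  _ (fine (conditional_entropy mu nu))).
- by move=> n; exact: entropy_ge0.
- by move=> n; exact: conditional_entropy_ge0.
- by rewrite fineK//; exact/liminf_ge_entropy/weakly_converges_convolution.
- by rewrite fineK//; exact: liminf_ge_conditional_entropy.
- rewrite EFinD !fineK// entropy_convolutionD//.
  under eq_fun do rewrite entropy_convolutionD//.
  by apply: cvgeD => //; exact: fin_num_adde_defr.
Qed.

End sequences.

End weak_convergence.

(** * Fekete's lemma and comparison of upper limits *)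

(** Writing n = qk + r with r < k gives a(n) <= q a(k) + a(r); after division by n the first term is
    at most a(k) / k and the second tends to 0. The infimum leaves out index 0, where the convention
    0^-1 = 0 would contribute the value 0. *)
Lemma fekete_cvg_inf (R : realType) (a : nat -> R) :
  (forall n, 0 <= a n)%R -> (forall m n, a (m + n)%N <= a m + a n)%R ->
  (n%:R^-1 * a n)%R @[n --> \oo] -->
    inf [set (n%:R^-1 * a n)%R | n in [set n | (0 < n)%N]].
Proof.
move=> a0 aD; set A := [set _ | _ in _].
have lbA : has_inf A.
  split; first by exists (1%:R^-1 * a 1%N)%R; exists 1%N.
  by exists 0%R => _ [n _ <-]; rewrite mulr_ge0 ?invr_ge0.
apply/cvgrPdist_lt => e e0.
have e20 : (0 < e / 2)%R by rewrite divr_gt0.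
have [_ [k /= k0 <-] ake] := inf_adherent e20 lbA.
have aq q r : (a (q * k + r)%N <= q%:R * a k + a r)%R.
  elim: q => [|q ih]; first by rewrite mul0n mul0r add0r.
  rewrite mulSn -addnA (le_trans (aD _ _))// -addn1 natrD mulrDl mul1r.
  by rewrite [X in (_ <= X + _)%R]addrC -addrA lerD2l.
(* [M] bounds a(r) for all remainders r < k at once. *)
pose M := (\sum_(i < k) a i)%R.
have M0 : (0 <= M)%R by exact: sumr_ge0.
near=> n.
have n0 : (0 < n)%N by near: n; exact: nbhs_infty_gt.
have nR : (0 < n%:R :> R)%R by rewrite ltr0n.
have kR : (0 < k%:R :> R)%R by rewrite ltr0n.
have Mn : (n%:R^-1 * M < e / 2)%R.
  rewrite ltr_pdivrMl// -ltr_pdivrMr//; near: n; exact: nbhs_infty_gtr.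
have infn : (inf A <= n%:R^-1 * a n)%R by apply: ge_inf; [case: lbA|exists n].
have anM : (a n <= (n %/ k)%:R * a k + M)%R.
  rewrite {1}(divn_eq n k) (le_trans (aq _ _))// lerD2l.
  have rk : (n %% k < k)%N by rewrite ltn_mod.
  by rewrite /M (bigD1 (Ordinal rk))//= lerDl sumr_ge0.
have nk : (n%:R^-1 * (n %/ k)%:R <= k%:R^-1 :> R)%R.
  by rewrite ler_pdivrMl// ler_pdivlMr// -natrM ler_nat leq_divM.
have : (n%:R^-1 * a n <= k%:R^-1 * a k + n%:R^-1 * M)%R.
  rewrite (@le_trans _ _ (n%:R^-1 * ((n %/ k)%:R * a k + M))%R)//.
    by rewrite ler_pM2l ?invr_gt0.
  by rewrite mulrDr mulrA lerD2r ler_wpM2r.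
rewrite distrC ger0_norm ?subr_ge0//; lra.
Unshelve. all: by end_near. Qed.

(** The upper limit is an infimum of suprema over the sets of the filter; each such set can be
    shrunk to its part where [u n <= v n]. *)
Lemma limn_esup_le_near (R : realType) (u v : nat -> \bar R) :
  (\forall n \near \oo, u n <= v n) -> limn_esup u <= limn_esup v.
Proof.
move=> uv; apply: le_ereal_inf_tmp => _ [V Voo <-].
apply: (@le_trans _ _ (ereal_sup (u @` (V `&` [set n | u n <= v n])))).
  apply: ereal_inf_lbound; exists (V `&` [set n | u n <= v n]) => //.
  exact: filterI.
apply: ge_ereal_sup => _ [n [Vn /= uvn] <-]; apply: (le_trans uvn).
by apply: ereal_sup_ubound; exists n.
Qed.

(** * Convolution powers and asymptotic entropy *)

Section powers.
Context (R : realType) (G : groupType).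
Implicit Types mu nu rho : probability (discrete_group G) R.

(** Identities between convolutions are established for point masses only; this transfers them to
    entropies. *)
Lemma eq_entropy mu nu : mass mu =1 mass nu -> entropy mu = entropy nu.
Proof. by move=> mn; apply: eq_esum => x _; rewrite -!/(mass _ x) mn. Qed.

Lemma entropy_dirac (x : discrete_group G) :
  entropy (\d_x : probability (discrete_group G) R) = 0.
Proof.
apply: esum1 => y _.
have -> : (\d_x : probability (discrete_group G) R) [set y] =
  (x \in [set y])%:R%:E by exact: diracE.
by case: (_ \in _); rewrite /= ?ln1 ?mulr0 ?mul0r oppr0.
Qed.

Lemma mass_convolution_dirac1l nu :
  mass (convolution (\d_(1%g : discrete_group G)) nu) =1 mass nu.
Proof.
move=> z; rewrite /mass /= /convolution integral_dirac//.
rewrite diracT mul1e; congr (fine (nu _)); apply/seteqP.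
by split=> y /=; rewrite mul1g.
Qed.

Lemma mass_convolution_dirac1r mu :
  mass (convolution mu (\d_(1%g : discrete_group G))) =1 mass mu.
Proof.
move=> z; rewrite /mass /= /convolution; congr fine.
transitivity (\int[mu]_x (\1_[set z] x)%:E); last first.
  by rewrite integral_indic// setIT.
apply: eq_integral => x _.
rewrite -[RHS]/(\d_x [set z]) -[LHS]/(\d_(1%g : discrete_group G) _).
rewrite !diracE; congr ((nat_of_bool _)%:R%:E).
by apply/idP/idP; rewrite !inE /= mulg1.
Qed.

Hypothesis cG : countable [set: G].

Lemma eq_mass_convolution mu nu rho : mass nu =1 mass rho ->
  mass (convolution mu nu) =1 mass (convolution mu rho).
Proof.
move=> nr z; apply: EFin_inj; rewrite !mass_convolution//.
by apply: eq_esum => x _; rewrite nr.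
Qed.

(** Both sides are the double sum over x and w, where x is the first factor and w the product of the
    first two. *)
Lemma mass_convolutionA mu nu rho :
  mass (convolution mu (convolution nu rho)) =1
  mass (convolution (convolution mu nu) rho).
Proof.
move=> z; apply: EFin_inj; rewrite !mass_convolution//.
transitivity (\esum_(x in setT) \esum_(w in setT)
    (mass mu x * mass nu (x^-1 * w)%g * mass rho (w^-1 * z)%g)%:E).
  apply: eq_esum => x _; rewrite EFinM mass_convolution//.
  rewrite -esumZl ?mass_ge0// => [|y]; last first.
    by rewrite lee_fin mulr_ge0 ?mass_ge0.
  (* The second factor y is replaced by x^-1 w. *)
  rewrite -(esum_translate (fun y => _ * _) x).
  by apply: eq_esum => w _; rewrite -EFinM mulrA invgM invgK mulgA mulgK.
rewrite exchange_esum => [|x w]; last by rewrite lee_fin !mulr_ge0 ?mass_ge0.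
apply: eq_esum => w _; under eq_esum do rewrite mulrC EFinM.
rewrite esumZl ?mass_ge0// => [|x]; last by rewrite lee_fin mulr_ge0 ?mass_ge0.
by rewrite -mass_convolution// -EFinM mulrC.
Qed.

Lemma mass_convolution_powerD mu m n :
  mass (convolution_power mu (m + n)) =1
  mass (convolution (convolution_power mu m) (convolution_power mu n)).
Proof.
elim: m => [|m ih] z /=; first by rewrite mass_convolution_dirac1l.
by rewrite (eq_mass_convolution _ ih) mass_convolutionA.
Qed.

Lemma entropy_convolution_powerD mu m n :
  entropy (convolution_power mu (m + n)) <=
  entropy (convolution_power mu m) + entropy (convolution_power mu n).
Proof.
rewrite (eq_entropy (mass_convolution_powerD mu m n)).
exact: entropy_convolution_le.
Qed.

Lemma entropy_convolution_power_fin_num mu n :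
  entropy mu \is a fin_num -> entropy (convolution_power mu n) \is a fin_num.
Proof.
move=> mu_fin; elim: n => [|n ih] /=; first by rewrite entropy_dirac.
rewrite ge0_fin_numE ?entropy_ge0//.
apply: le_lt_trans (entropy_convolution_le cG _ _) _.
by rewrite lte_add_pinfty// ltey_eq ?mu_fin ?ih.
Qed.

(** Each further convolution cannot decrease the entropy. The induction starts at exponent 1, as the
    power 0 is a unit mass of entropy 0. *)
Lemma entropy_convolution_power_ge mu n :
  entropy mu <= entropy (convolution_power mu n.+1).
Proof.
elim: n => [|n ih]; last exact: le_trans ih (entropy_convolution_ge cG _ _).
by rewrite /= (eq_entropy (mass_convolution_dirac1r mu)).
Qed.

(** Finite entropy makes the entropies of the powers a real subadditive sequence, to which Fekete's
    lemma applies. Convergence is recorded explicitly because [limn] does not by itself assert that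
    the limit exists. *)
Lemma asymptotic_entropy_cvg_le mu : entropy mu \is a fin_num ->
  (n%:R^-1)%:E * entropy (convolution_power mu n) @[n --> \oo] -->
    asymptotic_entropy mu /\
  forall k, (0 < k)%N -> asymptotic_entropy mu <=
    (k%:R^-1)%:E * entropy (convolution_power mu k).
Proof.
move=> mu_fin; pose a n := fine (entropy (convolution_power mu n)).
have aE n : entropy (convolution_power mu n) = (a n)%:E.
  by rewrite fineK// entropy_convolution_power_fin_num.
have a0 n : (0 <= a n)%R by rewrite -lee_fin -aE entropy_ge0.
have aD m n : (a (m + n)%N <= a m + a n)%R.
  by rewrite -lee_fin EFinD -!aE entropy_convolution_powerD.
have := fekete_cvg_inf a0 aD; set l := inf _ => al.
have cl : (n%:R^-1)%:E * entropy (convolution_power mu n) @[n --> \oo] --> l%:E.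
  under eq_fun do rewrite aE -EFinM.
  by apply: cvg_EFin al; exact: nearW.
have -> : asymptotic_entropy mu = l%:E by exact/cvg_lim.
split=> // k k0; rewrite aE -EFinM lee_fin; apply: ge_inf; last by exists k.
by exists 0%R => _ [n _ <-]; rewrite mulr_ge0 ?invr_ge0.
Qed.

Lemma asymptotic_entropy_infinite mu :
  entropy mu = +oo -> asymptotic_entropy mu = +oo.
Proof.
move=> mu_oo; apply/cvg_lim => //; apply: cvg_near_cst.
(* The sequence is constantly infinite from index 1 on; its term of index 0 is 0. *)
exists 1%N => // -[//|n] _ /=.
have := entropy_convolution_power_ge mu n; rewrite mu_oo leye_eq => /eqP ->.
by rewrite gt0_muley// lte_fin invr_gt0 ltr0n.
Qed.

End powers.

(** * Passage to the limit *)

(** The two convergences are proved in one induction, since the step for entropies needs the weak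
    convergence of the previous power. *)
Lemma cvg_convolution_power (R : realType) (G : groupType)
    (mu : probability (discrete_group G) R)
    (mu_ : nat -> probability (discrete_group G) R) k :
  countable [set: G] -> entropy mu \is a fin_num ->
  weakly_converges mu_ mu -> entropy (mu_ n) @[n --> \oo] --> entropy mu ->
  weakly_converges (fun n => convolution_power (mu_ n) k)
    (convolution_power mu k) /\
  entropy (convolution_power (mu_ n) k) @[n --> \oo] -->
    entropy (convolution_power mu k).
Proof.
move=> cG mu_fin mu_mu cmu; elim: k => [|k [wk ck]] /=.
  by split=> [x|]; exact: cvg_cst.
split; first exact: weakly_converges_convolution.
apply: cvg_entropy_convolution => //.
exact: entropy_convolution_power_fin_num.
Qed.

Unset Implicit Arguments.

Theorem proposition4 (R : realType) (G : groupType) (cG : countable [set: G])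
  (nu : probability (discrete_group G) R)
  (nu_ : nat -> probability (discrete_group G) R)
  (weak_cvg : weakly_converges nu_ nu)
  (entropy_cvg : entropy (nu_ n) @[n --> \oo] --> entropy nu) :
  limn_esup (fun n => asymptotic_entropy (nu_ n)) <= asymptotic_entropy nu.
Proof.
have [nu_oo|nu_fin] := eqVneq (entropy nu) +oo.
  by rewrite (asymptotic_entropy_infinite cG nu_oo) leey.
have {}nu_fin : entropy nu \is a fin_num.
  by rewrite ge0_fin_numE ?entropy_ge0// ltey.
(* Finitely many of the measures may still have infinite entropy; they do not affect the upper
   limit. *)
have nu_fin_near : \forall n \near \oo, entropy (nu_ n) \is a fin_num.
  by apply: (cvg_is_fine (a := fine (entropy nu))); rewrite fineK.
have [cvg_nu _] := asymptotic_entropy_cvg_le cG nu_fin.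
(* It suffices to bound the upper limit by H(nu^{*k}) / k for each k >= 1, and then to let k tend to
   infinity. *)
apply: (cvge_to_ge cvg_nu); exists 1%N => // k k0.
have [_ ck] := cvg_convolution_power k cG nu_fin weak_cvg entropy_cvg.
(* For fixed k this bound is the limit, hence the upper limit, of H(nu_n^{*k}) / k, which dominates
   the asymptotic entropy of nu_n as soon as H(nu_n) is finite. *)
have := cvgeZl (y := (k%:R^-1)%:E) erefl ck.
move=> /cvg_limn_einf_sup[_ <-]; apply: limn_esup_le_near.
apply: filterS nu_fin_near => n n_fin.
by have [_] := asymptotic_entropy_cvg_le cG n_fin; exact.
Qed.
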